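(* Let $R$ be a weakly periodic ring in which every nilpotent element is central (commutes multiplicatively with every element of $R$) and torsion (has finite order in the additive group of $R$). Then $R$ is periodic, $R$ is commutative, and $R$ is torsion (every element of $R$ has finite additive order).
   Context: Rings are associative, not necessarily commutative or unital. An element $b$ of a ring is potent if $b^m = b$ for some integer $m > 1$. A ring $R$ is weakly periodic if every $x \in R$ can be written as $x = a + b$ with $a$ nilpotent and $b$ potent. A ring $R$ is periodic if for each $x \in R$ the set $\{x^n : n \in \mathbb{N}\}$ is finite, where $\mathbb{N}$ is the set of positive integers; equivalently, for each $x \in R$ there are positive integers $m, n$ with $x^{m+n} = x^m$. *)

(* Defs.v *)
From HB Require Import structures.
From mathcomp Require Import all_boot ssralg.
From mathcomp Require Import classical_sets cardinality.

Set Implicit Arguments.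
Unset Strict Implicit.
Unset Printing Implicit Defensive.

Import GRing.Theory.
Local Open Scope ring_scope.

(* Associative rings that need be neither unital nor commutative. The          *)
(* multiplication is the one of semigroupType, so it is written (x * y)%g;     *)
(* in ring_scope the product sign is reserved for unital (semi)rings.          *)
HB.mixin Record Zmodule_Semigroup_isRng R of GRing.Zmodule R & Semigroup R := {
  rng_mulDl : forall x y z : R, ((x + y)%R * z)%g = (x * z)%g + (y * z)%g;
  rng_mulDr : forall x y z : R, (x * (y + z)%R)%g = (x * y)%g + (x * z)%g
}.

#[short(type="rngType")]
HB.structure Definition Rng :=
  {R of Zmodule_Semigroup_isRng R & GRing.Zmodule R & Semigroup R}.

(* There being no unit, only positive exponents are meaningful; the value at   *)
(* exponent 0 is junk, and every use below has a positive exponent.            *)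
Definition rng_exp (R : rngType) (x : R) (n : nat) : R :=
  iterop n (fun u v : R => (u * v)%g) x 0.

Definition rng_nilpotent (R : rngType) (x : R) : Prop :=
  exists n : nat, (0 < n)%N /\ rng_exp x n = 0.

Definition rng_potent (R : rngType) (x : R) : Prop :=
  exists m : nat, (1 < m)%N /\ rng_exp x m = x.

Definition rng_central (R : rngType) (x : R) : Prop :=
  forall y : R, commute x y.

Definition rng_torsion (R : rngType) (x : R) : Prop :=
  exists n : nat, (0 < n)%N /\ x *+ n = 0.

Definition weakly_periodic (R : rngType) : Prop :=
  forall x : R, exists a b : R,
    [/\ rng_nilpotent a, rng_potent b & x = a + b].

Definition periodic (R : rngType) : Prop :=
  forall x : R,
    finite_set [set rng_exp x n | n in [set n : nat | (0 < n)%N]]%classic.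

(* Main.v *)
Require Import Defs.
From HB Require Import structures.
From mathcomp Require Import all_boot ssralg.
From mathcomp Require Import all_algebra cyclic finfield.
From mathcomp Require Import boolp classical_sets cardinality.

(** The proof takes place in a unital ring U containing R as a two-sided ideal
    J, namely the ring of pairs (m, a) with m an integer and a in R.  As the
    nilpotents of J are central, they form an ideal N of U
    ([nil_ideal]), and writing x = a + b with a nilpotent and b potent shows
    that every x in J is potent modulo N ([potent_mod_nil]).

    Torsion.  Choose e > 1 with x ^ e = x and (2x) ^ e = 2x modulo N; then
    (2 ^ e - 2) x lies in N, so it is torsion, and hence so is x.

    Commutators are nilpotent.  This is Jacobson's theorem for J / N
    ([jacobson_modulo]).  If u = xy - yx is not in N, a maximal ideal avoiding
    u and containing N has as quotient a ring D in which every nonzero ideal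
    contains the image of u.  The image of J in D consists of potent elements,
    so its idempotents are central, and this forces every nonzero element of D
    to have finite multiplicative order ([monolithic_finite_order]).  Such a
    division ring is commutative ([finite_order_commutative]), by Herstein's
    argument: if a is not central and has order k, then X ^ k - 1 is the
    product of the X - a ^ i, and applying it to the operator of right
    multiplication by a, with left multiplications as coefficients, yields
    y <> 0 with y a = a ^ i y for some a ^ i <> a.  But then a and y span a
    finite domain, which is commutative by Wedderburn's little theorem.

    Commutativity.  Let x in J have additive order dividing n, and let
    d = xy - yx, which is central since it is nilpotent.  By induction on n,
    p x is central, i.e. p d = 0, for every prime p dividing n.  If two primes
    divide n, then d = 0.  Otherwise n is a power of p, so p x is nilpotent,
    the image of x in J / N lives in characteristic p, and the Frobenius map
    provides an exponent k divisible by p with x ^ k = x modulo N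
    ([primary_exponent]).  Hence d, which is also the commutator of x ^ k and
    y, equals k x ^ (k - 1) d = 0.

    Periodicity.  Write x ^ k = x + c with c nilpotent, c ^ t = 0 and n c = 0.
    With q = n t!, all the binomial coefficients 'C(q, i) with 0 < i < t are
    divisible by n, so x ^ (k q) = (x + c) ^ q = x ^ q
    ([weakly_periodic_powers]). *)

Set Implicit Arguments.
Unset Strict Implicit.
Unset Printing Implicit Defensive.

Import GRing.Theory.
Local Open Scope ring_scope.

(** * Finite domains inside a ring *)

Section FiniteSubring.
Variables (D : nzRingType) (S : subringClosed D) (s : seq D).
Hypothesis S_sub : {subset S <= s}.

(** The inclusion in a finite sequence is a parameter of the type, so that a
    finite ring structure can be attached to it. *)
Record finsub (S_sub : {subset S <= s}) :=
  FinSub {fsval :> D; fsvalP : fsval \in S}.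
Notation fs := (finsub S_sub).
HB.instance Definition _ := [isSub for @fsval S_sub].
HB.instance Definition _ := [Choice of fs by <:].
HB.instance Definition _ := [SubChoice_isSubNzRing of fs by <:].

Let seq_of (x : fs) : seq_sub s := SeqSub (S_sub (fsvalP x)).
Let of_seq (x : seq_sub s) : option fs := insub (ssval x).
Let seq_ofK : pcancel seq_of of_seq.
Proof. by move=> x; rewrite /of_seq valK. Qed.

HB.instance Definition _ : isCountable fs := PCanIsCountable seq_ofK.
HB.instance Definition _ : isFinite fs := PCanIsFinite seq_ofK.
HB.instance Definition _ := FinRing.isNzRing.Build fs.

(** Wedderburn's little theorem, transported to a finite subring. *)
Lemma finite_subdomain_commutes :
  (forall x y : D, x * y = 0 -> x = 0 \/ y = 0) -> {in S &, commutative *%R}.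
Proof.
move=> domD x y Sx Sy.
have dom : GRing.integral_domain_axiom fs.
  move=> u v /(congr1 val) /domD[] u0; apply/orP; [left|right];
    exact/eqP/val_inj.
have := finDomain_mulrC dom (FinSub S_sub Sx) (FinSub S_sub Sy).
by move=> /(congr1 val).
Qed.

End FiniteSubring.

(** In positive characteristic the additive span of a finite multiplicative
    submonoid is a finite subring, to which Wedderburn's theorem applies. *)
Lemma finite_mul_closed_commutes (D : nzRingType) (n : nat) (G : seq D) :
    (forall x y : D, x * y = 0 -> x = 0 \/ y = 0) ->
    (0 < n)%N -> n%:R = 0 :> D ->
    1 \in G -> {in G &, forall x y, x * y \in G} ->
  {in G &, commutative *%R}.
Proof.
move=> domD n_gt0 n0 G1 GM.
have mulrn_mod (x : D) k : x *+ (k %% n) = x *+ k.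
  rewrite [in RHS](divn_eq k n) mulrnDr mulnC mulrnA -[x *+ n]mulr_natl n0.
  by rewrite mul0r mul0rn add0r.
pose span (c : 'I_(size G) -> nat) : D := \sum_(i < size G) G`_i *+ c i.
pose s :=
  codom (fun c : {ffun 'I_(size G) -> 'I_n} => span (fun i => val (c i))).
have span_s c : span c \in s.
  apply/codomP; exists [ffun i => Ordinal (ltn_pmod (c i) n_gt0)].
  by apply: eq_bigr => i _; rewrite ffunE /= mulrn_mod.
have spanD u v : u \in s -> v \in s -> u + v \in s.
  move=> /codomP[c ->] /codomP[d ->].
  rewrite -big_split /=; under eq_bigr do rewrite -mulrnDr.
  exact: (span_s (fun i => val (c i) + val (d i))%N).
have spanMn u k : u \in s -> u *+ k \in s.
  move=> /codomP[c ->]; rewrite -sumrMnl.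
  under eq_bigr do rewrite -mulrnA.
  exact: (span_s (fun i => val (c i) * k)%N).
have G_s x : x \in G -> x \in s.
  rewrite -index_mem => xG; pose i := Ordinal xG.
  have -> : x = span (fun j => j == i).
    rewrite /span (bigD1 i) //= eqxx big1 => [|j /negPf->//].
    by rewrite addr0 nth_index -?index_mem.
  exact: span_s.
have s0 : 0 \in s by rewrite -(mulr0n 1) spanMn // G_s.
have s_sum I (r : seq I) (F : I -> D) :
    (forall i, F i \in s) -> \sum_(i <- r) F i \in s.
  by move=> Fs; apply: (big_ind (fun x => x \in s)).
have sC : subring_closed (mem s).
  split=> [|u v us vs|u v /codomP[c ->] /codomP[d ->]]; first exact: G_s.
    have -> : - v = v *+ n.-1.
      apply/eqP; rewrite eq_sym -addr_eq0 -mulrSr prednK //.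
      by rewrite -mulr_natl n0 mul0r.
    by rewrite spanD ?spanMn.
  rewrite mulr_suml; apply: (s_sum) => i; rewrite mulr_sumr; apply: s_sum => j.
  by rewrite mulrnAl mulrnAr !spanMn // G_s // GM // mem_nth.
pose S : subringClosed D :=
  HB.pack (mem s : {pred D}) (GRing.isSubringClosed.Build D (mem s) sC).
have Ss : {subset S <= s} by [].
move=> x y /G_s xs /G_s ys; exact: (finite_subdomain_commutes Ss).
Qed.

(** The relation between a and y moves all powers of a to the left, so the
    products a ^ i * y ^ j form a finite multiplicative monoid. *)
Lemma conjugate_power_commutes (D : nzRingType) (n k m t : nat) (a y : D) :
    (forall u v : D, u * v = 0 -> u = 0 \/ v = 0) ->
    (0 < n)%N -> n%:R = 0 :> D ->
    (0 < k)%N -> a ^+ k = 1 -> (0 < m)%N -> y ^+ m = 1 ->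
  y * a = a ^+ t * y -> a * y = y * a.
Proof.
move=> domD n_gt0 n0 k_gt0 ak m_gt0 ym ya.
pose G := [seq a ^+ i * y ^+ j | i <- iota 0 k, j <- iota 0 m].
have GE i j : a ^+ i * y ^+ j \in G.
  rewrite -(expr_mod i ak) -(expr_mod j ym).
  by apply/allpairsP; exists (i %% k, j %% m)%N; rewrite !mem_iota !ltn_pmod.
have yaX i : y * a ^+ i = a ^+ (t * i) * y.
  elim: i => [|i IH]; rewrite ?muln0 ?mulr1 ?mul1r //.
  by rewrite exprS mulrA ya -mulrA IH mulrA -exprD mulnS.
have yXaX j i : y ^+ j * a ^+ i = a ^+ (t ^ j * i) * y ^+ j.
  elim: j i => [|j IH] i; first by rewrite mul1n mulr1 mul1r.
  by rewrite exprS -mulrA IH mulrA yaX -mulrA mulnA -expnS.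
have -> : a = a ^+ 1 * y ^+ 0 by rewrite mulr1.
have -> : y = a ^+ 0 * y ^+ 1 by rewrite mul1r.
apply: (finite_mul_closed_commutes domD n_gt0 n0 _ _ (GE 1 0) (GE 0 1))%N.
  by have := GE 0 0; rewrite mulr1.
move=> _ _ /allpairsP[[i j] [_ _ ->]] /allpairsP[[i' j'] [_ _ ->]] /=.
by rewrite mulrA -(mulrA _ (y ^+ j)) yXaX mulrA -exprD -mulrA -exprD.
Qed.

(** * Division rings whose elements have finite order *)

(** As evaluation puts the coefficients on the left, (p * x%:P).[a] is the sum
    of the p`_i * x * a ^+ i: it is p, with coefficients acting by left
    multiplication, applied at x to the operator of right multiplication by a.
    The factor 'X - z%:P acts as the operator x |-> x * a - z * x. *)
Lemma twisted_eval_XsubC (D : nzRingType) (p : {poly D}) (z a x : D) :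
  (p * ('X - z%:P) * x%:P).[a] = (p * (x * a - z * x)%:P).[a].
Proof.
have -> : p * ('X - z%:P) * x%:P =
    p * x%:P * ('X - a%:P) + p * (x * a - z * x)%:P.
  rewrite -!mulrA -mulrDr; congr (_ * _).
  by rewrite polyCB !polyCM mulrBl mulrBr commr_polyX addrA subrK.
rewrite hornerD; have /factor_theorem :
  exists q, p * x%:P * ('X - a%:P) = q * ('X - a%:P) by exists (p * x%:P).
by rewrite rootE => /eqP ->; rewrite add0r.
Qed.

(** If a product of linear factors kills a nonzero x, then one of the factors
    kills a nonzero vector: apply the factors to x one after the other. *)
Lemma twisted_eigenvector (D : nzRingType) (rs : seq D) (a x : D) :
    ((\prod_(z <- rs) ('X - z%:P)) * x%:P).[a] = 0 -> x != 0 ->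
  exists y z, [/\ y != 0, z \in rs & y * a = z * y].
Proof.
elim/last_ind: rs x => [|rs z IH] x.
  by rewrite big_nil mul1r hornerC => ->; rewrite eqxx.
rewrite -cats1 big_cat big_seq1 cats1 /= twisted_eval_XsubC => Px0 x0.
have [xa|xa] := eqVneq (x * a - z * x) 0.
  exists x, z; rewrite mem_rcons mem_head x0; split=> //.
  by apply/eqP; rewrite -subr_eq0 xa.
have [y [w [y0 wr yw]]] := IH _ Px0 xa.
by exists y, w; rewrite mem_rcons in_cons wr orbT.
Qed.

(** The factors commute with one another, so X ^ k - 1 factors as it does over a
    field.  The first exponent m is arbitrary so that any given power of z can
    be made the rightmost factor. *)
Lemma consecutive_powers_factor (U : unitRingType) k m (z : U) :
    (forall x : U, x != 0 -> x \is a GRing.unit) -> k.-primitive_root z ->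
  \prod_(w <- [seq z ^+ i | i <- iota m k]) ('X - w%:P) = 'X^k - 1.
Proof.
move=> U_skew zk; have k_gt0 := prim_order_gt0 zk.
set rs := [seq z ^+ i | i <- iota m k].
have uniq_rs : uniq rs.
  rewrite map_inj_in_uniq ?iota_uniq // => i j.
  rewrite !mem_iota => /andP[mi ik] /andP[mj jk] /eqP.
  rewrite (eq_prim_root_expr zk) -(subnKC mi) -(subnKC mj) eqn_modDl.
  by rewrite !modn_small ?ltn_subLR // => /eqP->.
have uroots_rs : uniq_roots rs.
  move: uniq_rs; rewrite /rs; elim: (iota m k) => //= i s IH /andP[i_s us].
  rewrite IH // andbT; apply/allP=> w ws; apply/andP; split.
    by case/mapP: ws => j _ ->; rewrite -!exprD addnC.
  by apply: U_skew; rewrite subr_eq0; apply: contraNneq i_s => <-.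
rewrite [RHS](@all_roots_prod_XsubC _ _ rs) //.
- by rewrite (monicP (monicXnsubC 1 k_gt0)) scale1r.
- by rewrite size_XnsubC // size_map size_iota.
- apply/allP=> _ /mapP[i _ ->] /=.
  rewrite rootE hornerD hornerN hornerXn -polyC1 hornerC.
  by rewrite exprAC (prim_expr_order zk) expr1n subrr.
Qed.

Section FiniteOrder.
Variable D : nzRingType.
Hypothesis finite_order :
  forall x : D, x != 0 -> exists2 n, (0 < n)%N & x ^+ n = 1.

Lemma finite_order_domain (x y : D) : x * y = 0 -> x = 0 \/ y = 0.
Proof.
have [-> _|/finite_order[n n_gt0 xn] xy] := eqVneq x 0; [by left|right].
by rewrite -[y]mul1r -xn -(prednK n_gt0) exprSr -mulrA xy mulr0.
Qed.

(** If 2 is nonzero, it satisfies 2 ^ n = 1 for some n > 0. *)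
Lemma finite_order_char : exists2 n, (0 < n)%N & n%:R = 0 :> D.
Proof.
have [two0|/finite_order[n n_gt0 two_n]] := eqVneq (2%:R : D) 0.
  by exists 2.
exists (2 ^ n - 1)%N; first by rewrite subn_gt0 -{1}(expn0 2) ltn_exp2l.
by rewrite natrB ?expn_gt0 // natrX two_n subrr.
Qed.

End FiniteOrder.

(** Given a and x that do not commute, x a - a x is nonzero and is killed by the
    product of the factors X - a ^ i with a ^ i <> a, because the remaining
    factor X - a turns x into it and the whole product X ^ k - 1 kills x.  The
    resulting y with y a = a ^ t y and a ^ t <> a contradicts
    [conjugate_power_commutes]. *)
Lemma finite_order_unitRing_commutative (U : unitRingType) :
    (forall x : U, x != 0 -> exists2 n, (0 < n)%N & x ^+ n = 1) ->
  commutative ( *%R : U -> U -> U).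
Proof.
move=> finite_order a x; apply: contrapT => ax.
have U_skew (z : U) : z != 0 -> z \is a GRing.unit.
  by move=> /finite_order[n n_gt0 zn]; rewrite -(unitrX_pos _ n_gt0) zn unitr1.
have [k0 k0_gt0 ak0] : exists2 k, (0 < k)%N & a ^+ k = 1.
  by apply: finite_order; apply/eqP=> a0; apply: ax; rewrite a0 mul0r mulr0.
have [k ak _] := prim_order_exists k0_gt0 ak0; have k_gt0 := prim_order_gt0 ak.
have akk := prim_expr_order ak.
have := consecutive_powers_factor 2 U_skew ak.
case: k k_gt0 ak akk => // k k_gt0 ak akk.
(* The exponents 2, ..., k + 2 put the factor X - a = X - a ^ (k + 2) last. *)
have -> : iota 2 k.+1 = iota 2 k ++ [:: k.+2].
  by have := iotaD 2 k 1; rewrite addn1.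
rewrite map_cat big_cat /= big_seq1 exprS akk mulr1 => factorX.
pose d := x * a - a * x.
have d0 : d != 0 by rewrite subr_eq0; apply/eqP=> xa; apply: ax.
have Pd :
    (\prod_(z <- [seq a ^+ i | i <- iota 2 k]) ('X - z%:P) * d%:P).[a] = 0.
  rewrite /d -twisted_eval_XsubC factorX mulrBl mul1r hornerD hornerN hornerC.
  by rewrite -commr_polyXn mul_polyC hornerZ hornerXn akk mulr1 subrr.
have [y [z [y0 /mapP[t]]]] := twisted_eigenvector Pd d0.
rewrite mem_iota => /andP[t2 tk] -> ya.
have domU := finite_order_domain finite_order.
have [m m_gt0 ym] := finite_order _ y0.
have [n n_gt0 n0] := finite_order_char finite_order.
have ay := conjugate_power_commutes domU n_gt0 n0 k_gt0 akk m_gt0 ym ya.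
have : (a ^+ t - a) * y = 0 by rewrite mulrBl -ya ay subrr.
case/domU => /eqP; last by rewrite (negPf y0).
rewrite subr_eq0 -{2}[a]expr1 (eq_prim_root_expr ak).
by rewrite eqn_mod_dvd ?(ltnW t2) // gtnNdvd ?subn_gt0 // ltn_subLR ?(ltnW t2).
Qed.

Lemma finite_order_commutative (D : nzRingType) :
    (forall x : D, x != 0 -> exists2 n, (0 < n)%N & x ^+ n = 1) ->
  commutative ( *%R : D -> D -> D).
Proof.
move=> finite_order.
have /choice[e eP] :
    forall x : D, exists y, x != 0 -> x * y = 1 /\ y * x = 1.
  move=> x; have [->|/finite_order[n n_gt0 xn]] := eqVneq x 0.
    by exists 0.
  by exists (x ^+ n.-1); rewrite -exprS -exprSr prednK.
pose inv x := if x == 0 then 0 else e x.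
have mulVx : {in predC1 0, left_inverse 1 inv *%R}.
  by move=> x /= x0; rewrite /inv (negPf x0); case: (eP x x0).
have mulxV : {in predC1 0, right_inverse 1 inv *%R}.
  by move=> x /= x0; rewrite /inv (negPf x0); case: (eP x x0).
have unitE (x y : D) : y * x = 1 /\ x * y = 1 -> predC1 0 x.
  case=> _ xy; apply/eqP=> x0; move: xy; rewrite x0 mul0r => /eqP.
  by rewrite eq_sym oner_eq0.
have inv_out : {in [predC predC1 0], inv =1 id}.
  by move=> x; rewrite !inE negbK /inv => /eqP->; rewrite eqxx.
pose U : unitRingType := HB.pack D
  (GRing.NzRing_hasMulInverse.Build D mulVx mulxV unitE inv_out).
exact: (@finite_order_unitRing_commutative U).
Qed.

(** * Two-sided ideals and their quotients *)

Record two_sided_ideal (U : nzRingType) (I : set U) : Prop := TwoSidedIdeal {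
  ideal0 : I 0;
  idealB : forall x y, I x -> I y -> I (x - y);
  idealMl : forall u x, I x -> I (u * x);
  idealMr : forall u x, I x -> I (x * u) }.

Section IdealTheory.
Variables (U : nzRingType) (I : set U).
Hypothesis idI : two_sided_ideal I.

Lemma idealN x : I x -> I (- x).
Proof.
by move=> Ix; rewrite -[- x]add0r; apply: (idealB idI) => //; apply: ideal0.
Qed.

Lemma idealD x y : I x -> I y -> I (x + y).
Proof.
by move=> Ix Iy; rewrite -[y]opprK; apply: (idealB idI) => //; apply: idealN.
Qed.

Lemma idealMn x n : I x -> I (x *+ n).
Proof. by move=> Ix; rewrite -mulr_natl; apply: idealMl. Qed.

Lemma ideal_trans x y z : I (x - y) -> I (y - z) -> I (x - z).
Proof. by move=> xy yz; have := idealD xy yz; rewrite addrA subrK. Qed.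

Lemma ideal_sym x y : I (x - y) -> I (y - x).
Proof. by rewrite -(opprB x); apply: idealN. Qed.

Lemma ideal_congM x x' y y' : I (x - x') -> I (y - y') -> I (x * y - x' * y').
Proof.
move=> xx' yy'; apply: (@ideal_trans _ (x' * y)).
  by rewrite -mulrBl; apply: idealMr.
by rewrite -mulrBr; apply: idealMl.
Qed.

Lemma ideal_congX x y n : I (x - y) -> I (x ^+ n - y ^+ n).
Proof.
move=> xy; elim: n => [|n IH]; first by rewrite subrr; apply: ideal0.
by rewrite !exprS; apply: ideal_congM.
Qed.

Lemma ideal_quotient : ~ I 1 ->
  exists (D : nzRingType) (f : {rmorphism U -> D}),
    (forall y, exists x, y = f x) /\ (forall x, f x = 0 <-> I x).
Proof.
move=> I1; pose S : {pred U} := fun x => `[< I x >].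
have SP x : reflect (I x) (x \in S) by exact: asboolP.
have S_zmod : zmod_closed S.
  split; first exact/SP/(ideal0 idI).
  by move=> x y /SP Ix /SP Iy; apply/SP/(idealB idI).
pose SZ : zmodClosed U := HB.pack S (GRing.isZmodClosed.Build U S S_zmod).
pose Q := Quotient.quot SZ; pose p : U -> Q := \pi_Q%qT.
have pE x y : p x = p y <-> I (x - y).
  rewrite (rwP eqP) (rwP (SP _)) -[x - y \in S]/(x - y \in SZ).
  by rewrite Quotient.idealrBE.
have pK (x : Q) : p (repr x) = x by apply: reprK.
have pD x y : p (x + y) = p x + p y by rewrite /p [LHS]Quotient.pi_add.
have p0 : p 0 = 0 by apply: (addrI (p 0)); rewrite -pD !addr0.
pose one : Q := p 1; pose mul (x y : Q) : Q := p (repr x * repr y).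
have pM x y : p (x * y) = mul (p x) (p y).
  by apply/pE/ideal_congM; apply/pE; rewrite pK.
have mulA : associative mul.
  by move=> x y z; rewrite -[x]pK -[y]pK -[z]pK -!pM mulrA.
have mul1 : left_id one mul by move=> x; rewrite -[x]pK -pM mul1r.
have mulI : right_id one mul by move=> x; rewrite -[x]pK -pM mulr1.
have mulDl : left_distributive mul +%R.
  by move=> x y z; rewrite -[x]pK -[y]pK -[z]pK -pD -!pM mulrDl pD.
have mulDr : right_distributive mul +%R.
  by move=> x y z; rewrite -[x]pK -[y]pK -[z]pK -pD -!pM mulrDr pD.
have one0 : one != 0.
  by apply/eqP; rewrite -p0 => /pE; rewrite subr0.
pose D : nzRingType := HB.pack Q
  (GRing.Zmodule_isNzRing.Build Q mulA mul1 mulI mulDl mulDr one0).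
have pB : zmod_morphism (p : U -> D).
  by move=> x y; apply: (addIr (p y)); rewrite -pD !subrK.
have pM1 : monoid_morphism (p : U -> D) by split.
pose f : {rmorphism U -> D} :=
  HB.pack (p : U -> D) (GRing.isZmodMorphism.Build U D p pB)
    (GRing.isMonoidMorphism.Build U D p pM1).
exists D, f; split=> [y|x]; first by exists (repr y); rewrite -[LHS]pK.
by rewrite -[f x]/(p x) -[0]p0 pE subr0.
Qed.

End IdealTheory.

(** * Jacobson's theorem modulo an ideal *)

Lemma maximal_ideal_avoiding (U : nzRingType) (N : set U) (u : U) :
    two_sided_ideal N -> ~ N u ->
  exists I : set U, [/\ two_sided_ideal I, N `<=` I, ~ I u &
    forall B, two_sided_ideal B -> I `<=` B -> ~ B u -> B `<=` I]%classic.
Proof.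
move=> idN Nu.
(* The empty chain has an empty union, which is no ideal: adding N to all    *)
(* the sets repairs this.                                                    *)
pose P (A : set U) :=
  two_sided_ideal (A `|` N)%classic /\ ~ (A `|` N)%classic u.
have [F FP Ftot|A [[idA Au] A_max]] := @Zorn_bigcup U P; last first.
  exists (A `|` N)%classic; split=> // B idB AB Bu.
  have BN : (B `|` N = B)%classic by apply/setUidPl => x Nx; apply: AB; right.
  have PB : P B by rewrite /P BN.
  apply: contrapT => BA; apply: (A_max B) => //; split=> [|BA']; last first.
    by apply: BA => x /BA' Ax; left.
  by move=> x Ax; apply: AB; left.
have [F0|/set0P[A0 FA0]] := eqVneq F set0.
  by rewrite /P F0 bigcup_set0 set0U.
split; last first.
  move=> [[A FA Au]|//]; have [_ []] := FP A FA; by left.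
have common x y : (\bigcup_(X in F) X `|` N)%classic x ->
    (\bigcup_(X in F) X `|` N)%classic y ->
    exists A, [/\ F A, (A `|` N)%classic x & (A `|` N)%classic y].
  move=> [[A FA Ax]|Nx] [[B FB By]|Ny].
  - by have [AB|BA] := Ftot A B FA FB; [exists B|exists A];
      split=> //; left=> //; [exact: AB|exact: BA].
  - by exists A; split=> //; [left|right].
  - by exists B; split=> //; [right|left].
  - by exists A0; split=> //; right.
have up A x : F A -> (A `|` N)%classic x ->
    (\bigcup_(X in F) X `|` N)%classic x.
  by move=> FA [Ax|Nx]; [left; exists A|right].
split.
- by right; apply: ideal0 idN.
- move=> x y ux uy; have [A [FA Ax Ay]] := common x y ux uy.
  by have [idA _] := FP A FA; apply: (up A) => //; apply: (idealB idA).
- move=> v x ux; have [A [FA Ax _]] := common x x ux ux.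
  by have [idA _] := FP A FA; apply: (up A) => //; apply: (idealMl idA).
- move=> v x ux; have [A [FA Ax _]] := common x x ux ux.
  by have [idA _] := FP A FA; apply: (up A) => //; apply: (idealMr idA).
Qed.

(** An ideal of potent elements contains no nonzero element of square zero, but
    e x - e x e and x e - e x e both have square zero. *)
Lemma potent_idempotent_central (D : nzRingType) (K : set D) (e : D) :
    two_sided_ideal K ->
    (forall x, K x -> exists2 r, (0 < r)%N & x ^+ r.+1 = x) ->
    K e -> e * e = e ->
  forall x, e * x = x * e.
Proof.
move=> idK Kpot Ke ee x.
have reduced y : K y -> y * y = 0 -> y = 0.
  by move=> /Kpot[[//|r] _ yr] yy; rewrite -yr !exprS mulrA yy mul0r.
have Kex z : K (e * z) by apply: (idealMr idK).
have Kxe z : K (z * e) by apply: (idealMl idK).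
have ex : e * x - e * x * e = 0.
  apply: reduced; first by apply: (idealB idK) => //; rewrite -mulrA.
  have we : (e * x - e * x * e) * e = 0 by rewrite mulrBl -!mulrA ee subrr.
  by rewrite -{2}[e * x * e]mulrA -mulrBr mulrA we mul0r.
have xe : x * e - e * x * e = 0.
  apply: reduced; first by apply: (idealB idK) => //; rewrite -mulrA.
  have we : e * (x * e - e * x * e) = 0 by rewrite mulrBr !mulrA ee subrr.
  rewrite [LHS](congr2 *%R (esym (mulrBl e x (e * x))) erefl).
  by rewrite -mulrA we mulr0.
rewrite -[LHS](subrK (e * x * e)) ex add0r.
by rewrite -[RHS](subrK (e * x * e)) xe add0r.
Qed.

(** For y nonzero in K with y ^+ r.+1 = y, the power e = y ^+ r is a nonzero
    central idempotent.  The ideal e D contains e, hence u, so e u = u; then u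
    is not in the annihilator of e, which is thus the zero ideal and contains
    1 - e.  So e = 1; as K contains u != 0, it contains 1 and is all of D. *)
Lemma monolithic_finite_order (D : nzRingType) (K : set D) (u : D) :
    two_sided_ideal K ->
    (forall x, K x -> exists2 r, (0 < r)%N & x ^+ r.+1 = x) ->
    K u -> u != 0 ->
    (forall B, two_sided_ideal B -> (exists2 x, B x & x != 0) -> B u) ->
  forall x : D, x != 0 -> exists2 n, (0 < n)%N & x ^+ n = 1.
Proof.
move=> idK Kpot Ku u0 u_min.
have power_one y : K y -> y != 0 -> exists2 r, (0 < r)%N & y ^+ r = 1.
  move=> Ky y0; have [r r_gt0 yr] := Kpot y Ky; exists r => //.
  set e := y ^+ r.
  have ey : e * y = y by rewrite -exprSr.
  have ee : e * e = e.
    by rewrite /e -{2}(prednK r_gt0) exprS mulrA ey -exprS prednK.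
  have e0 : e != 0 by apply: contraNneq y0 => e0; rewrite -ey e0 mul0r.
  have Ke : K e by rewrite /e -(prednK r_gt0) exprS; apply: idealMr.
  have eC := potent_idempotent_central idK Kpot Ke ee.
  have eu : e * u = u.
    apply: (u_min (fun x => e * x = x)); last by exists e.
    split=> [|x z ex ez|z x ex|z x ex]; first by rewrite mulr0.
    - by rewrite mulrBr ex ez.
    - by rewrite mulrA eC -mulrA ex.
    - by rewrite mulrA ex.
  apply: contrapT => e1.
  have /eqP : e * u = 0.
    apply: (u_min (fun x => e * x = 0)).
      split=> [|x z ex ez|z x ex|z x ex]; first by rewrite mulr0.
      - by rewrite mulrBr ex ez subrr.
      - by rewrite mulrA eC -mulrA ex mulr0.
      - by rewrite mulrA ex mul0r.
    exists (1 - e); first by rewrite mulrBr mulr1 ee subrr.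
    by rewrite subr_eq0 eq_sym; apply/eqP.
  by rewrite eu (negPf u0).
have [r r_gt0 ur] := power_one u Ku u0.
move=> x x0; apply: power_one => //.
rewrite -[x]mulr1 -ur -(prednK r_gt0) exprS mulrA.
exact/(idealMr idK)/(idealMl idK).
Qed.

(** Jacobson's theorem for J / N.  The quotient by an ideal that contains N and
    is maximal among those avoiding the commutator is commutative, so it kills
    the commutator after all. *)
Lemma jacobson_modulo (U : nzRingType) (J N : set U) :
    two_sided_ideal J -> two_sided_ideal N ->
    (forall x, J x -> exists2 r, (0 < r)%N & N (x ^+ r.+1 - x)) ->
  forall x y, J x -> J y -> N (x * y - y * x).
Proof.
move=> idJ idN Jpot x y Jx Jy; apply: contrapT => Nu.
have [I [idI NI Iu I_max]] := maximal_ideal_avoiding idN Nu.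
have I1 : ~ I 1.
  by move=> I1; apply: Iu; rewrite -[_ - _]mulr1; apply: (idealMl idI).
have [D [f [f_surj fI]]] := ideal_quotient idI I1.
pose K : set D := [set f z | z in J]%classic.
have idK : two_sided_ideal K.
  split.
  - by exists 0; [exact: ideal0 idJ|rewrite rmorph0].
  - move=> _ _ [a Ja <-] [b Jb <-].
    by exists (a - b); [exact: idealB|rewrite rmorphB].
  - move=> w _ [a Ja <-]; have [v ->] := f_surj w.
    by exists (v * a); [exact: (idealMl idJ)|rewrite rmorphM].
  - move=> w _ [a Ja <-]; have [v ->] := f_surj w.
    by exists (a * v); [exact: (idealMr idJ)|rewrite rmorphM].
have Kpot z : K z -> exists2 r, (0 < r)%N & z ^+ r.+1 = z.
  move=> [a /Jpot[r r_gt0 /NI/fI ar] <-]; exists r => //.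
  by apply/eqP; rewrite -subr_eq0 -rmorphXn -rmorphB ar.
have Ku : K (f (x * y - y * x)).
  by exists (x * y - y * x) => //; apply: (idealB idJ); apply: (idealMl idJ).
have u0 : f (x * y - y * x) != 0 by apply/eqP=> /fI.
have u_min B : two_sided_ideal B -> (exists2 w, B w & w != 0) ->
    B (f (x * y - y * x)).
  move=> idB [w Bw w0]; apply: contrapT => Bu.
  have idfB : two_sided_ideal (f @^-1` B)%classic.
    split; rewrite /preimage /=.
    - by rewrite rmorph0; apply: ideal0 idB.
    - by move=> a b Ba Bb; rewrite rmorphB; apply: (idealB idB).
    - by move=> v a Ba; rewrite rmorphM; apply: (idealMl idB).
    - by move=> v a Ba; rewrite rmorphM; apply: (idealMr idB).
  have [v wv] := f_surj w.
  have /fI : I v.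
    apply: (I_max _ idfB) => //; last by rewrite /preimage /= -wv.
    by move=> a /fI fa; rewrite /preimage /= fa; apply: ideal0 idB.
  by rewrite -wv => /eqP; rewrite (negPf w0).
have D_finite_order := monolithic_finite_order idK Kpot Ku u0 u_min.
have xy := finite_order_commutative D_finite_order (f x) (f y).
by case/eqP: u0; rewrite rmorphB !rmorphM xy subrr.
Qed.

(** * Ideals whose elements are nilpotent plus potent *)

(** Freshman's dream modulo an ideal containing p u. *)
Lemma ideal_exprD_prime (U : nzRingType) (I : set U) (p : nat) (u v : U) :
    two_sided_ideal I -> prime p -> GRing.comm u v -> I (u *+ p) ->
  I ((u + v) ^+ p - (u ^+ p + v ^+ p)).
Proof.
case: p => [|[|q]] // idI p_pr uv pu; set p := q.+2 in p_pr pu *.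
rewrite (exprDn_comm p uv) big_ord_recl big_ord_recr /=.
rewrite /bump /= add1n subnn subn0 bin0 binn !mulr1n expr0 mulr1 mul1r.
rewrite addrCA addrK; apply: (big_ind I) => [|w z|i _]; first exact: ideal0 idI.
  exact: (idealD idI).
rewrite add1n subSS; have /dvdnP[d ->] : (p %| 'C(p, i.+1))%N.
  by apply: prime_dvd_bin => //=; rewrite ltnS.
rewrite -mulrnAl mulnC mulrnA; apply: (idealMr idI); apply: (idealMn idI).
rewrite subSn ?leq_ord // exprSr -mulrnAr; exact: (idealMl idI).
Qed.

(** Since i 'C(q, i) = q 'C(q - 1, i - 1) and i divides t!, the factor n of
    q = n t! survives in 'C(q, i). *)
Lemma dvdn_bin_mul_fact n t i : (i < t)%N -> (n %| 'C(n * t`!, i.+1))%N.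
Proof.
move=> it; have /dvdnP[d dE] : (i.+1 %| t`!)%N by apply: dvdn_fact.
set q := (n * t`!)%N; apply/dvdnP; exists (d * 'C(q.-1, i))%N.
apply/eqP; rewrite -(eqn_pmul2l (ltn0Sn i)) -mul_bin_diag {1}/q dE; apply/eqP.
by rewrite -!mulnA mulnCA [in RHS]mulnCA; congr muln; rewrite mulnC mulnA.
Qed.

Section NilCentral.
Variables (U : nzRingType) (J : set U).
Hypothesis idJ : two_sided_ideal J.
Let N : set U := [set a | J a /\ exists n, a ^+ n = 0]%classic.

Hypothesis nil_central : forall a u, N a -> GRing.comm a u.

Lemma nil_ideal : two_sided_ideal N.
Proof.
split.
- by split; [exact: ideal0|exists 1%N].
- move=> x y Nx Ny; have cxy : GRing.comm x (- y) by apply/commrN/nil_central.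
  have [[Jx [n xn]] [Jy [m ym]]] := (Nx, Ny).
  split; [exact: idealB|exists (n + m)%N].
  rewrite exprDn_comm // big1 // => i _.
  have [mi|im] := leqP m i.
    by rewrite exprNn -(subnK mi) [y ^+ _]exprD ym !mulr0 mul0rn.
  by rewrite -addnBA ?(ltnW im) // exprD xn !mul0r mul0rn.
- move=> u x Nx; have [Jx [n xn]] := Nx.
  split; [exact: idealMl|exists n].
  by rewrite exprMn_comm ?xn ?mulr0 //; apply/commr_sym/nil_central.
- move=> u x Nx; have [Jx [n xn]] := Nx.
  split; [exact: idealMr|exists n].
  by rewrite exprMn_comm ?xn ?mul0r //; apply/nil_central.
Qed.

Hypothesis nil_plus_potent : forall x, J x ->
  exists a b, [/\ N a, J b, exists2 r, (0 < r)%N & b ^+ r.+1 = b & x = a + b].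

(** If x = a + b with a in N and b ^ m = b, then x ^ m = b ^ m = b = x modulo
    the ideal N. *)
Lemma potent_mod_nil x : J x -> exists2 r, (0 < r)%N & N (x ^+ r.+1 - x).
Proof.
move=> /nil_plus_potent[a [b [Na Jb [r r_gt0 br] xab]]]; exists r => //.
have xb : N (x - b) by rewrite xab addrK.
apply: (ideal_trans nil_ideal (ideal_congX nil_ideal r.+1 xb)).
rewrite br; exact: (ideal_sym nil_ideal xb).
Qed.

Lemma potent_mod_nil_iter x r j : N (x ^+ r.+1 - x) -> N (x ^+ (r * j).+1 - x).
Proof.
move=> xr; elim: j => [|j IH].
  by rewrite muln0 subrr; apply: ideal0 nil_ideal.
apply: (ideal_trans nil_ideal _ xr).
have -> : x ^+ (r * j.+1).+1 = x ^+ (r * j).+1 * x ^+ r.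
  by rewrite -exprD mulnS addSn addnC.
rewrite [x ^+ r.+1]exprS -mulrBl; exact: idealMr nil_ideal _ _ IH.
Qed.

Hypothesis nil_torsion : forall a, N a -> exists2 n, (0 < n)%N & a *+ n = 0.

(** With e = rs + 1 a common exponent for x and 2x modulo N, the elements
    (2x) ^ e = 2 ^ e x and 2x agree modulo N, so (2 ^ e - 2) x is nilpotent. *)
Lemma weakly_periodic_torsion x : J x -> exists2 n, (0 < n)%N & x *+ n = 0.
Proof.
move=> Jx; have J2 : J (x *+ 2) by apply: idealMn.
have [r r_gt0 xr] := potent_mod_nil Jx; have [s s_gt0 xs] := potent_mod_nil J2.
have xrs := potent_mod_nil_iter s xr; have := potent_mod_nil_iter r xs.
rewrite mulnC exprMn_n => x2rs.
have : N (x *+ (2 ^ (r * s).+1 - 2)).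
  rewrite mulrnBr; last by rewrite expnS leq_pmulr ?expn_gt0.
  apply: (ideal_trans nil_ideal _ x2rs).
  by rewrite -mulrnBl; apply: (idealMn nil_ideal); apply: (ideal_sym nil_ideal).
move=> /nil_torsion[n n_gt0 xn].
exists ((2 ^ (r * s).+1 - 2) * n)%N; last by rewrite mulrnA.
rewrite muln_gt0 n_gt0 andbT subn_gt0.
have : (2 ^ 1 < 2 ^ (r * s).+1)%N by rewrite ltn_exp2l // ltnS muln_gt0 r_gt0.
by rewrite expn1.
Qed.

Lemma commutator_nil x y : J x -> J y -> N (x * y - y * x).
Proof. exact: jacobson_modulo idJ nil_ideal potent_mod_nil x y. Qed.

(** The commutator of x and y is nilpotent, hence central, so the derivation
    given by y satisfies the commutative power rule at x. *)
Lemma commutatorX x y n : J x -> J y ->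
  x ^+ n.+1 * y - y * x ^+ n.+1 = x ^+ n * (x * y - y * x) *+ n.+1.
Proof.
move=> Jx Jy; have dC := nil_central x (commutator_nil Jx Jy).
elim: n => [|n IH]; first by rewrite mul1r.
have leibniz z :
    x * z * y - y * (x * z) = x * (z * y - y * z) + (x * y - y * x) * z.
  by rewrite mulrBr mulrBl !mulrA addrA subrK.
by rewrite exprS leibniz IH mulrnAr mulrA -exprS [RHS]mulrSr (commrX n.+1 dC).
Qed.

(** Modulo N the map z |-> z ^ p is additive on the powers of x, and it is
    injective since N contains every element of J with a power in N.  So
    x ^ (r' p + 1) = x, multiplied by x ^ (p - 1), reads
    (x ^ (r' + 1)) ^ p = x ^ p and gives x ^ (r' + 1) = x: there is r coprime
    to p with x ^ (r + 1) = x.  By Euler's theorem some positive power of p is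
    1 modulo r, so it can serve as the exponent. *)
Lemma primary_exponent x p k : prime p -> J x -> x *+ (p ^ k) = 0 ->
  exists n, N (x ^+ (p * n.+1) - x).
Proof.
move=> p_pr Jx xpk.
have Npx : N (x *+ p).
  split; [exact: idealMn|exists k.+1].
  by rewrite exprMn_n exprS -mulrnAl expnSr mulrnA xpk mul0rn mul0r.
have [r rp xr] : exists2 r, coprime p r & N (x ^+ r.+1 - x).
  have [r r_gt0] := potent_mod_nil Jx.
  elim/ltn_ind: r r_gt0 => r IH r_gt0 xr.
  have [cpr|] := boolP (coprime p r); first by exists r.
  rewrite prime_coprime // negbK => /dvdnP[r' rE].
  move: r_gt0 xr; rewrite {}rE in IH *.
  rewrite muln_gt0 => /andP[r'_gt0 _] xr.
  apply: (IH r') => //; first by rewrite -{1}[r']muln1 ltn_pmul2l ?prime_gt1.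
  have xE : (x ^+ r'.+1 - x) + x = x ^+ r'.+1 by rewrite subrK.
  set u := _ - x in xE *.
  have ux : GRing.comm u x.
    by apply/commr_sym/commrB; [apply: commrX|].
  have up : N (u *+ p).
    rewrite mulrnBl; apply: (idealB nil_ideal) => //.
    by rewrite exprSr -mulrnAr; apply: (idealMl nil_ideal).
  have upx := ideal_exprD_prime nil_ideal p_pr ux up.
  have xp : N ((u + x) ^+ p - x ^+ p).
    have -> : (u + x) ^+ p - x ^+ p = (x ^+ (r' * p).+1 - x) * x ^+ p.-1.
      rewrite xE -exprM mulrBl -exprD -exprS prednK ?prime_gt0 //.
      by rewrite mulSn addSn addnC -addnS prednK ?prime_gt0 // addnC.
    exact: (idealMr nil_ideal).
  have [_ [n un]] : N (u ^+ p).
    have -> : u ^+ p =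
        (u + x) ^+ p - x ^+ p - ((u + x) ^+ p - (u ^+ p + x ^+ p)).
      by rewrite opprB addrC addrA subrK addrK.
    exact: (idealB nil_ideal).
  split; last by exists (p * n)%N; rewrite exprM.
  by apply: (idealB idJ) => //; rewrite exprS; apply: (idealMr idJ).
have r_gt0 : (0 < r)%N.
  case: r rp {xr} => //; rewrite /coprime gcdn0 => /eqP p1.
  by rewrite p1 in p_pr.
have /dvdnP[j jE] : (r %| p ^ totient r - 1)%N.
  by rewrite -eqn_mod_dvd ?expn_gt0 ?prime_gt0 //; apply/eqP/Euler_exp_totient.
exists (p ^ (totient r).-1).-1.
rewrite prednK ?expn_gt0 ?prime_gt0 // -expnS prednK ?totient_gt0 //.
rewrite -[(p ^ _)%N](@subnK 1) ?expn_gt0 ?prime_gt0 // jE addn1 mulnC.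
exact: potent_mod_nil_iter.
Qed.

(** Induction on a multiple n of the additive order of x.  For a prime p
    dividing n, p x is central by induction, so p kills the commutator d of x
    and y.  Two different primes dividing n give d = 0; if n is a power of p,
    then x may be replaced in d by x ^ (p m), whose commutator with y is a
    multiple of p d. *)
Lemma nil_central_commutative x y : J x -> J y -> x * y = y * x.
Proof.
move=> Jx Jy; have [n n_gt0] := weakly_periodic_torsion Jx.
elim/ltn_ind: n x n_gt0 Jx => n IH x n_gt0 Jx xn.
apply/eqP; rewrite -subr_eq0; set d := _ - _.
have Nd : N d := commutator_nil Jx Jy.
have dp p : prime p -> (p %| n)%N -> d *+ p = 0.
  move=> p_pr /dvdnP[m nE]; rewrite {}nE in IH n_gt0 xn.
  move: n_gt0; rewrite muln_gt0 => /andP[m_gt0 p_gt0].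
  have mp : (m < m * p)%N by rewrite -{1}[m]muln1 ltn_pmul2l ?prime_gt1.
  have xpm : x *+ p *+ m = 0 by rewrite -mulrnA mulnC.
  have xpy := IH m mp _ m_gt0 (idealMn idJ p Jx) xpm.
  by rewrite mulrnBl -mulrnAl -mulrnAr xpy subrr.
have [n1|n_gt1] := leqP n 1.
  have n_eq1 : n = 1%N by apply/eqP; rewrite eqn_leq n1.
  by move: xn; rewrite /d n_eq1 mulr1n => ->; rewrite mul0r mulr0 subrr.
pose p := pdiv n; have p_pr : prime p := pdiv_prime n_gt1.
have pn : (p %| n)%N := pdiv_dvd n.
have [/p_natP[k nE]|] := boolP (p.-nat n).
  rewrite nE in xn; have [m xm] := primary_exponent p_pr Jx xn.
  have : x ^+ (p * m.+1) * y - y * x ^+ (p * m.+1) = d.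
    rewrite -[x ^+ _](subrK x) mulrDl mulrDr.
    by rewrite (nil_central y xm) opprD addrACA subrr add0r.
  rewrite -(prednK (prime_gt0 p_pr)) mulSn addSn commutatorX //.
  rewrite -addSn -mulSn prednK ?prime_gt0 // mulrnA -mulrnAr dp //.
  by rewrite mulr0 mul0rn => <-.
move=> pnat; have [q [q_pr qn qp]] :
    exists q, [/\ prime q, (q %| n)%N & q != p].
  apply: contrapT => no_q; case/negP: pnat; apply/pnatP => // q q_pr qn.
  rewrite inE; apply: contrapT => qp; apply: no_q.
  by exists q; split=> //; apply/negP.
have cpq : coprime p q by rewrite prime_coprime // dvdn_prime2 // eq_sym.
case: (egcdnP q (prime_gt0 p_pr)) => u v uv _.
rewrite (eqP (cpq : gcdn p q == 1%N)) in uv.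
have d_mul l k : prime l -> (l %| n)%N -> d *+ (k * l) = 0.
  by move=> l_pr ln; rewrite mulnC mulrnA dp // mul0rn.
have := congr1 (fun k => d *+ k) uv.
by rewrite mulrnDr (d_mul p) // (d_mul q) // add0r => /esym/eqP.
Qed.

(** With x ^ (r + 1) = x + c, c ^ t = 0 and n c = 0, every term of the binomial
    expansion of (x + c) ^ (n t!) other than x ^ (n t!) vanishes, either because
    it contains c ^ t or because n divides its binomial coefficient. *)
Lemma weakly_periodic_powers x : J x ->
  exists q t, [/\ (0 < q)%N, (0 < t)%N & x ^+ (q + t) = x ^+ q].
Proof.
move=> Jx; have [r r_gt0 Nc] := potent_mod_nil Jx.
set c := _ - x in Nc; have [Jc [t ct]] := Nc.
have [n n_gt0 cn] := nil_torsion Nc.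
pose q := (n * t`!)%N.
have q_gt0 : (0 < q)%N by rewrite muln_gt0 n_gt0 fact_gt0.
exists q, (r * q)%N; split=> //; first by rewrite muln_gt0 r_gt0.
rewrite -mulSn exprM.
have -> : x ^+ r.+1 = x + c by rewrite addrC subrK.
rewrite exprDn_comm; last exact/commr_sym/nil_central.
rewrite big_ord_recl /= bin0 subn0 mulr1 mulr1n big1 ?addr0 // => i _.
rewrite /bump /= add1n.
have [ti|it] := leqP t i.+1.
  by rewrite (_ : c ^+ _ = 0) ?mulr0 ?mul0rn // -(subnK ti) exprD ct mulr0.
have /dvdnP[d ->] : (n %| 'C(q, i.+1))%N.
  exact/dvdn_bin_mul_fact/ltnW.
rewrite exprS mulnC mulrnA -mulrnAr -mulrnAl cn.
by rewrite mul0r mulr0 mul0rn.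
Qed.

End NilCentral.

(** * Adjoining a unit *)

Section Unitization.
Variable R : rngType.
Implicit Types a b c : R.

Lemma rng_mulr_zmod_morphism a : zmod_morphism (fun b => (a * b)%g).
Proof.
by move=> b c; apply: (addIr (a * c)%g); rewrite -rng_mulDr !subrK.
Qed.

Lemma rng_mull_zmod_morphism b : zmod_morphism (fun a => (a * b)%g).
Proof.
by move=> a c; apply: (addIr (c * b)%g); rewrite -rng_mulDl !subrK.
Qed.

Lemma rng_mulrMz a b (m : int) : (a * (b *~ m)%R)%g = (a * b)%g *~ m.
Proof.
pose f : {additive R -> R} := HB.pack (fun b => (a * b)%g)
  (GRing.isZmodMorphism.Build R R _ (rng_mulr_zmod_morphism a)).
exact: (raddfMz f).
Qed.

Lemma rng_mulrlMz a b (m : int) : ((a *~ m)%R * b)%g = (a * b)%g *~ m.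
Proof.
pose f : {additive R -> R} := HB.pack (fun a => (a * b)%g)
  (GRing.isZmodMorphism.Build R R _ (rng_mull_zmod_morphism b)).
exact: (raddfMz f).
Qed.

(** Dorroh's extension: (m, a) stands for m + a. *)
Definition unitization : Type := (int * R)%type.
HB.instance Definition _ := GRing.Zmodule.on unitization.
Implicit Types u v w : unitization.

Definition unitization_mul u v : unitization :=
  (u.1 * v.1, (u.2 * v.2)%g + v.2 *~ u.1 + u.2 *~ v.1).

Fact unitization_mulA : associative unitization_mul.
Proof.
move=> [m a] [n b] [p c]; congr (_, _) => /=; first exact: mulrA.
rewrite !rng_mulDl !rng_mulDr !rng_mulrMz !rng_mulrlMz !mulrzDl mulgA -!mulrzA.
rewrite (mulrC n m) (mulrC p m).
by rewrite [LHS](AC (3*3*1) ((1*4*2)*5*(3*6*7))).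
Qed.

Fact unitization_mul1 : left_id ((1, 0) : unitization) unitization_mul.
Proof.
move=> [n b]; rewrite /unitization_mul /= mul1r mul0rz addr0 mulr1z.
by rewrite -[X in (X * b)%g](mulr0z 0) rng_mulrlMz mulr0z add0r.
Qed.

Fact unitization_mulr1 : right_id ((1, 0) : unitization) unitization_mul.
Proof.
move=> [n b]; rewrite /unitization_mul /= mulr1 mul0rz addr0 mulr1z.
by rewrite -[X in (b * X)%g](mulr0z 0) rng_mulrMz mulr0z add0r.
Qed.

Fact unitization_mulDl : left_distributive unitization_mul +%R.
Proof.
move=> [m a] [n b] [p c]; congr (_, _) => /=; first exact: mulrDl.
rewrite rng_mulDl mulrzDl mulrzDr.
by rewrite [LHS](AC ((2*2)*2) ((1*3*5)*(2*4*6))).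
Qed.

Fact unitization_mulDr : right_distributive unitization_mul +%R.
Proof.
move=> [m a] [n b] [p c]; congr (_, _) => /=; first exact: mulrDr.
rewrite rng_mulDr mulrzDl mulrzDr.
by rewrite [LHS](AC ((2*2)*2) ((1*3*5)*(2*4*6))).
Qed.

Fact unitization_1neq0 : ((1, 0) : unitization) != 0.
Proof. by apply/eqP=> /(congr1 fst). Qed.

HB.instance Definition _ := GRing.Zmodule_isNzRing.Build unitization
  unitization_mulA unitization_mul1 unitization_mulr1
  unitization_mulDl unitization_mulDr unitization_1neq0.

Definition unitize a : unitization := (0, a).

End Unitization.

Section UnitizationTheory.
Variable R : rngType.
Implicit Types a b : R.

Lemma unitize_inj : injective (@unitize R).
Proof. by move=> a b []. Qed.

Lemma unitizeD a b : unitize (a + b) = unitize a + unitize b.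
Proof. by congr (_, _); rewrite /= addr0. Qed.

Lemma unitizeMn a n : unitize (a *+ n) = unitize a *+ n.
Proof. by elim: n => [|n IH] //; rewrite !mulrS unitizeD IH. Qed.

Lemma unitizeM a b : unitize (a * b)%g = unitize a * unitize b.
Proof. by congr (_, _); rewrite /= !mulr0z !addr0. Qed.

Lemma unitize_exp a n : (0 < n)%N -> unitize (rng_exp a n) = unitize a ^+ n.
Proof.
case: n => // n _; rewrite /rng_exp iteropS.
by elim: n => [|n IH] //; rewrite iterS unitizeM IH [RHS]exprS.
Qed.

Definition unitize_ideal : set (unitization R) := range (@unitize R).

Lemma unitize_idealE u : unitize_ideal u <-> u.1 = 0.
Proof. by split=> [[a _ <-]|]; [|case: u => m a /= ->; exists a]. Qed.

Lemma two_sided_unitize_ideal : two_sided_ideal unitize_ideal.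
Proof.
split=> [|u v|u v|u v]; rewrite !unitize_idealE //=.
- by move=> -> ->; rewrite subr0.
- by move=> ->; rewrite mulr0.
- by move=> ->; rewrite mul0r.
Qed.

Lemma unitize_nilpotent a : rng_nilpotent a <-> exists n, unitize a ^+ n = 0.
Proof.
split=> [[n [n_gt0 an]]|[[|n] an]].
- by exists n; rewrite -unitize_exp // an.
- by have /eqP := an; rewrite expr0 oner_eq0.
- by exists n.+1; split=> //; apply: unitize_inj; rewrite unitize_exp.
Qed.

Lemma unitize_central a : rng_central a -> forall u, GRing.comm (unitize a) u.
Proof.
move=> aC [m b]; congr (_, _) => /=; first by rewrite mul0r mulr0.
by rewrite !mulr0z !addr0 (aC b).
Qed.

End UnitizationTheory.

(** * Rings with central torsion nilpotents *)

Theorem corollary2p4 (R : rngType)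
    (R_wp : weakly_periodic R)
    (nil_central : forall x : R, rng_nilpotent x -> rng_central x)
    (nil_torsion : forall x : R, rng_nilpotent x -> rng_torsion x) :
  [/\ periodic R,
      forall x y : R, commute x y
    & forall x : R, rng_torsion x].
Proof.
pose U := unitization R; pose J : set U := @unitize_ideal R.
have idJ : two_sided_ideal J := @two_sided_unitize_ideal R.
have J_unitize x : J (unitize x) by exists x.
pose N : set U := [set a | J a /\ exists n, a ^+ n = 0]%classic.
have U_central a u : N a -> GRing.comm a u.
  move=> [[x _ <-] /unitize_nilpotent/nil_central xC].
  exact: unitize_central.
have U_torsion a : N a -> exists2 n, (0 < n)%N & a *+ n = 0.
  move=> [[x _ <-] /unitize_nilpotent/nil_torsion[n [n_gt0 xn]]].
  by exists n => //; rewrite -unitizeMn xn.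
have U_wp u : J u -> exists a b,
    [/\ N a, J b, exists2 r, (0 < r)%N & b ^+ r.+1 = b & u = a + b].
  move=> [x _ <-]; have [a [b [a_nil [m [m_gt1 bm]] ->]]] := R_wp x.
  exists (unitize a), (unitize b); rewrite -unitizeD; split=> //.
    by split; [|exact/unitize_nilpotent].
  case: m m_gt1 bm => // m m_gt0 bm; exists m => //.
  by rewrite -unitize_exp // bm.
split=> [x|x y|x].
- have [q [t [q_gt0 t_gt0 xqt]]] :=
    weakly_periodic_powers idJ U_central U_wp U_torsion (J_unitize x).
  (* Every positive exponent is reduced below q + t by subtracting t. *)
  apply: (@sub_finite_set _ _ (rng_exp x @` `I_(q + t))%classic).
    move=> _ /= [n n_gt0 <-].
    have [m [m_gt0 mqt xmn]] : exists m, [/\ (0 < m)%N, (m < q + t)%N &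
        unitize x ^+ m = unitize x ^+ n].
      elim/ltn_ind: n n_gt0 => n IH n_gt0.
      have [nqt|qtn] := ltnP n (q + t); first by exists n.
      have [||m [m_gt0 mqt xmn]] := IH (n - t)%N.
      + by rewrite ltn_subrL t_gt0.
      + by rewrite subn_gt0 (leq_trans _ qtn) // -{1}[t]add0n ltn_add2r.
      exists m; split=> //; rewrite xmn.
      have nE : n = (n - (q + t) + (q + t))%N by rewrite subnK.
      rewrite {2}nE exprD xqt -exprD; congr (_ ^+ _).
      by rewrite {1}nE addnA addnK.
    by exists m => //; apply: unitize_inj; rewrite !unitize_exp.
  exact/finite_image/finite_II.
- by apply: unitize_inj; rewrite !unitizeM;
    apply: (nil_central_commutative idJ U_central U_wp U_torsion).
- have [n n_gt0 xn] :=
    weakly_periodic_torsion idJ U_central U_wp U_torsion (J_unitize x).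
  by exists n; split=> //; apply: unitize_inj; rewrite unitizeMn.
Qed.
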